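(* Let $n>2$, $N=\{1,\dots,n\}$, $a_k>0$ for all $k\in N$, $\beta=\sum_{k\in N}a_k$, $0<\ell<u<+\infty$, $0<p<q$, and let $i,j\in N$ be distinct. Let $f:\mathbb{R}^n_+\to\mathbb{R}_+$, $f(x)=\prod_{k\in N}x_k^{a_k}$, $X=\{x\in\mathbb{R}^n_+:\ell\le f(x)\le u\}$, and $W_{ij}=\{x\in\mathbb{R}^n_+: p x_i\le x_j\le q x_i\}$. If $\beta\le 1$, then the upper envelope $E_U(f,X\cap W_{ij})$ of $f$ over $X\cap W_{ij}$ is the set of all $(x,z)\in\mathbb{R}^n_+\times\mathbb{R}$ such that $$z\le\prod_{k\in N}x_k^{a_k},\qquad z\le u,\qquad p x_i\le x_j\le q x_i,\qquad \prod_{k\in N}x_k^{a_k}\ge \ell .$$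
   Context: $\mathbb{R}_+$ denotes the nonnegative reals. For $T\subseteq\mathbb{R}^n$ and a real-valued function $f$ defined on $T$, the hypograph of $f$ in $T$ is $\mathrm{hyp}(f,T)=\{(x,z)\in T\times\mathbb{R}: z\le f(x)\}$, and the upper envelope $E_U(f,T)$ is the convex hull of $\mathrm{hyp}(f,T)$. *)

(* Defs.v *)
From HB Require Import structures.
From mathcomp Require Import all_boot all_order all_algebra.
From mathcomp Require Import all_classical all_reals all_analysis.

Set Implicit Arguments.
Unset Strict Implicit.
Unset Printing Implicit Defensive.

Import Order.TTheory GRing.Theory Num.Theory.

Local Open Scope classical_set_scope.
Local Open Scope ring_scope.

Definition convex_hull (R : realType) (V : lmodType R) (S : set V) : set V :=
  smallest (@convex_set R V) S.

(* A real-valued function on a subset T of R^n is represented by a total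
   function on row vectors; only its values on T matter below.  R^o is R
   regarded as a module over itself, so that R^n x R is an R-module. *)
Definition hypograph (R : realType) (n : nat) (f : 'rV[R]_n -> R)
    (T : set 'rV[R]_n) : set ('rV[R]_n * R^o) :=
  [set w | T w.1 /\ (w.2 : R) <= f w.1].

Definition upper_envelope (R : realType) (n : nat) (f : 'rV[R]_n -> R)
    (T : set 'rV[R]_n) : set ('rV[R]_n * R^o) :=
  convex_hull (hypograph f T).

Definition orthant (R : realType) (n : nat) : set 'rV[R]_n :=
  [set x | forall k, 0 <= x 0 k].

(* Meaningful on the nonnegative orthant: there, for exponents a k > 0,
   `^ is the usual real power, with 0 `^ a k = 0; on negative bases it takes
   a junk value. *)
Definition power_monomial (R : realType) (n : nat) (a : 'I_n -> R)
    (x : 'rV[R]_n) : R :=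
  \prod_(k < n) x 0 k `^ a k.

Definition level_band (R : realType) (n : nat) (f : 'rV[R]_n -> R) (l u : R) :
    set 'rV[R]_n :=
  [set x | orthant x /\ l <= f x <= u].

Definition ratio_cone (R : realType) (n : nat) (p q : R) (i j : 'I_n) :
    set 'rV[R]_n :=
  [set x | orthant x /\ p * x 0 i <= x 0 j <= q * x 0 i].

(* Main.v *)
Require Import Defs.
From HB Require Import structures.
From mathcomp Require Import all_boot all_order all_algebra.
From mathcomp Require Import all_classical all_reals all_analysis.
From mathcomp Require Import ring lra.

(** The right-hand side is convex because a weighted geometric mean with total
    weight at most 1 is concave, and it contains the hypograph. Conversely, a
    point (x, z) of the right-hand side with f x > u leaves {f > u} in both
    directions along the line that scales x_i and x_j jointly by 1 + t and some
    third coordinate x_k by 1 - t. This line stays in the ratio cone, and at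
    the two exit points f equals u, so (x, z) is a convex combination of two
    points of the hypograph at the same height z <= u. *)

Set Implicit Arguments.
Unset Strict Implicit.
Unset Printing Implicit Defensive.

Import Order.TTheory GRing.Theory Num.Theory.

Local Open Scope classical_set_scope.
Local Open Scope ring_scope.

Section PowerMonomial.
Variables (R : realType) (n : nat) (a : 'I_n -> R).

Lemma power_monomial_expR (x : 'rV[R]_n) : (forall k, 0 < x 0 k) ->
  power_monomial a x = expR (\sum_k a k * ln (x 0 k)).
Proof.
move=> x0; rewrite expR_sum; apply: eq_bigr => k _.
by rewrite /powR gt_eqF.
Qed.

Lemma power_monomial_gt0 (x : 'rV[R]_n) :
  (forall k, 0 < x 0 k) -> 0 < power_monomial a x.
Proof. by move=> x0; rewrite power_monomial_expR// expR_gt0. Qed.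

Lemma power_monomial_mul (x r : 'rV[R]_n) : orthant x -> orthant r ->
  power_monomial a (\row_k (x 0 k * r 0 k)) =
  power_monomial a x * power_monomial a r.
Proof.
move=> x0 r0; rewrite -big_split; apply: eq_bigr => k _.
by rewrite mxE powRM.
Qed.

Lemma power_monomial_gt0_coord (x : 'rV[R]_n) : (forall k, 0 < a k) ->
  orthant x -> 0 < power_monomial a x -> forall k, 0 < x 0 k.
Proof.
move=> a0 x0 fx k; rewrite lt_neqAle x0 andbT eq_sym; apply/eqP => xk.
by move: fx; rewrite /power_monomial (bigD1 k)//= xk powR0 ?gt_eqF// mul0r ltxx.
Qed.

Hypotheses (a_gt0 : forall k, 0 < a k) (a_sum : \sum_k a k <= 1).

(* The missing weight [1 - \sum_k a k] is carried by an extra term equal to 1. *)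
Lemma weighted_AGM (r : 'rV[R]_n) : (forall k, 0 < r 0 k) ->
  power_monomial a r <= \sum_k a k * r 0 k + (1 - \sum_k a k).
Proof.
move=> r0; rewrite power_monomial_expR//.
set v := \sum_k a k * ln (r 0 k); set b := \sum_k a k.
(* The exponential lies above its tangent line at [v]. *)
have tangent y : expR v * (1 + (y - v)) <= expR y.
  rewrite -[in leRHS](subrK v y) expRD [leRHS]mulrC.
  by rewrite ler_pM2l ?expR_gt0// expR_ge1Dx.
(* The points [ln (r 0 k)] with weights [a k] and the point 0 with weight [1 - b] have mean [v], so
   the tangent line at [v] takes the average value [expR v] on them. *)
have -> : expR v = \sum_k a k * (expR v * (1 + (ln (r 0 k) - v))) +
                   (1 - b) * (expR v * (1 + (0 - v))).
  have -> : \sum_k a k * (expR v * (1 + (ln (r 0 k) - v))) =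
            expR v * (b * (1 - v) + v).
    rewrite {3}/v /b mulr_suml -big_split mulr_sumr; apply: eq_bigr => k _ /=.
    by ring.
  by ring.
apply: lerD.
  apply: ler_sum => k _; rewrite ler_pM2l//.
  by rewrite (le_trans (tangent _))// lnK// posrE.
by rewrite ler_piMr ?subr_ge0// (le_trans (tangent _))// expR0.
Qed.

(** Multiplicativity and [weighted_AGM], applied to the ratios [x 0 k / m 0 k] and [y 0 k / m 0 k]
    at the mixed point [m], bound both values by one function affine in the point. Its average over
    [x] and [y] is the value at [m]. *)
Lemma power_monomial_concave (s : R) (x y : 'rV[R]_n) :
  0 <= s <= 1 -> (forall k, 0 < x 0 k) -> (forall k, 0 < y 0 k) ->
  s * power_monomial a x + (1 - s) * power_monomial a y <=
  power_monomial a (s *: x + (1 - s) *: y).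
Proof.
move=> /andP[s0 s1] x0 y0; set m := s *: x + _.
have mE k : m 0 k = s * x 0 k + (1 - s) * y 0 k by rewrite !mxE.
have m0 k : 0 < m 0 k.
  rewrite mE; have [->|sn0] := eqVneq s 0.
    by rewrite mul0r add0r subr0 mul1r.
  by rewrite ltr_wpDr ?mulr_ge0 ?subr_ge0// ?(ltW (y0 k))// mulr_gt0// lt0r sn0.
have tangent (z : 'rV[R]_n) : (forall k, 0 < z 0 k) -> power_monomial a z <=
    power_monomial a m * (\sum_k a k * (z 0 k / m 0 k) + (1 - \sum_k a k)).
  move=> z0; pose r : 'rV[R]_n := \row_k (z 0 k / m 0 k).
  have r0 k : 0 < r 0 k by rewrite mxE divr_gt0.
  have zE : z = \row_k (m 0 k * r 0 k).
    by apply/rowP => k; rewrite mxE [r 0 k]mxE mulrC divfK// gt_eqF.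
  rewrite [in leLHS]zE power_monomial_mul; [|by move=> k; exact: ltW..].
  rewrite ler_pM2l ?power_monomial_gt0// (le_trans (weighted_AGM r0))//.
  by rewrite lerD2r; apply: ler_sum => k _; rewrite mxE.
have sum_m : s * (\sum_k a k * (x 0 k / m 0 k)) +
    (1 - s) * (\sum_k a k * (y 0 k / m 0 k)) = \sum_k a k.
  rewrite !mulr_sumr -big_split; apply: eq_bigr => k _ /=.
  transitivity (a k * (m 0 k / m 0 k)); first by rewrite {3}mE; ring.
  by rewrite divff ?mulr1// gt_eqF.
have s1' : 0 <= 1 - s by rewrite subr_ge0.
have := lerD (ler_wpM2l s0 (tangent _ x0)) (ler_wpM2l s1' (tangent _ y0)).
by move/le_trans; apply; rewrite -sum_m le_eqVlt; apply/predU1P; left; ring.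
Qed.

End PowerMonomial.

Section Tradeoff.
Import numFieldNormedType.Exports.

(** The intermediate value theorem for the logarithm [h] of the left-hand side, which is 0 at 0 and
    falls below [ln c] before [t] reaches 1. *)
Lemma powR_tradeoff (R : realType) (A B c : R) : 0 < A -> 0 < B ->
  0 < c < 1 -> exists2 t, 0 < t < 1 & (1 + t) `^ A * (1 - t) `^ B = c.
Proof.
move=> A0 B0 /andP[c0 c1].
pose h (t : R) : R := A * ln (1 + t) + B * ln (1 - t).
have lnc : ln c < 0 by rewrite ln_lt0 ?c0.
have ln2 : 0 <= ln 2%:R :> R by rewrite ln_ge0// ler1n.
(* [M] solves [A * ln 2 - B * M = ln c]. With [1 - t0 = expR (- M)] and [1 + t0 <= 2] this gives
   [h t0 <= ln c], while [t0 < 1] keeps both logarithms away from 0. *)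
pose M := (A * ln 2%:R - ln c) / B.
have M0 : 0 < M.
  by rewrite divr_gt0// subr_gt0 (lt_le_trans lnc)// mulr_ge0// ltW.
pose t0 := 1 - expR (- M).
have t0_gt0 : 0 < t0 by rewrite subr_gt0 expR_lt1 oppr_lt0.
have t0_lt1 : t0 < 1 by rewrite ltrBlDr ltrDl expR_gt0.
have hC : {within `[0, t0], continuous h}.
  apply: continuous_in_subspaceT => t tin.
  have /andP[tge0 tle] : 0 <= t <= t0 by move: tin; rewrite inE/= in_itv.
  apply: cvgD; apply: cvgMr.
    apply: (@continuous_comp R R R (fun t => 1 + t) (@ln R)).
      by apply: cvgD; [exact: cvg_cst|exact: cvg_id].
    by apply: continuous_ln; lra.
  apply: (@continuous_comp R R R (fun t => 1 - t) (@ln R)).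
    by apply: cvgB; [exact: cvg_cst|exact: cvg_id].
  by apply: continuous_ln; lra.
have h0 : h 0 = 0 by rewrite /h addr0 subr0 ln1 !mulr0 addr0.
have ht0 : h t0 <= ln c.
  have le2 : A * ln (1 + t0) <= A * ln 2%:R.
    by rewrite ler_pM2l// ler_ln ?posrE; lra.
  have -> : h t0 = A * ln (1 + t0) - (A * ln 2%:R - ln c).
    rewrite /h; congr (_ + _).
    by rewrite /t0 opprB addrCA subrr addr0 expRK /M; field; rewrite gt_eqF.
  by lra.
have cmm : Num.min (h 0) (h t0) <= ln c <= Num.max (h 0) (h t0).
  by rewrite h0 ge_min ht0 orbT le_max ltW.
have [t] := IVT (ltW t0_gt0) hC cmm.
rewrite in_itv/= => /andP[tge0 tle] htc.
have t_gt0 : 0 < t.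
  rewrite lt_neqAle tge0 andbT; apply: contraTneq lnc => tE.
  by rewrite -htc -tE h0 ltxx.
exists t; first by rewrite t_gt0 (le_lt_trans tle).
rewrite /powR !gt_eqF; [|by lra..].
by rewrite -expRD -/(h t) htc lnK.
Qed.

End Tradeoff.

Section ExitLine.
Variables (R : realType) (n : nat) (a : 'I_n -> R) (i j k : 'I_n).
Hypotheses (ij : i != j) (ki : k != i) (kj : k != j).

(** Coordinatewise multipliers, affine in [t]: the equal factors at [i] and [j] preserve the ratio
    of these coordinates, and the factor at [k] opposes them. *)
Definition tilt (t : R) : 'rV[R]_n :=
  \row_m (if (m == i) || (m == j) then 1 + t else if m == k then 1 - t else 1).

Lemma power_monomial_tilt (t : R) : -1 < t < 1 ->
  power_monomial a (tilt t) = (1 + t) `^ (a i + a j) * (1 - t) `^ a k.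
Proof.
move=> /andP[tN1 t1]; have t_neq0 : 1 + t != 0 by rewrite gt_eqF//; lra.
rewrite powRD ?t_neq0 ?implybT//.
rewrite /power_monomial (bigD1 i)//= (bigD1 j) 1?eq_sym//= (bigD1 k) ?ki//=.
rewrite !mxE !eqxx (negPf ki) (negPf kj) orbT /= big1 ?mulr1 ?mulrA//.
move=> m /andP[/andP[/negPf mi /negPf mj] /negPf mk].
by rewrite mxE mi mj mk powR1.
Qed.

(** Replacing [t] by [- t] exchanges the factors [1 + t] and [1 - t], so both directions are
    instances of [powR_tradeoff] with the two exponents swapped. *)
Lemma power_monomial_tilt_exit (c : R) : (forall m, 0 < a m) -> 0 < c < 1 ->
  exists s t, [/\ 0 < s < 1, 0 < t < 1,
    power_monomial a (tilt s) = c & power_monomial a (tilt (- t)) = c].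
Proof.
move=> a0 c01.
have [s s01 sE] := powR_tradeoff (addr_gt0 (a0 i) (a0 j)) (a0 k) c01.
have [t t01 tE] := powR_tradeoff (a0 k) (addr_gt0 (a0 i) (a0 j)) c01.
exists s, t; split => //; rewrite power_monomial_tilt ?sE//; [by lra| |by lra].
by rewrite opprK mulrC.
Qed.

End ExitLine.

Lemma third_index (n : nat) (i j : 'I_n) : (2 < n)%N ->
  exists k : 'I_n, (k != i) && (k != j).
Proof.
move=> n2; case: (pickP [pred k | (k != i) && (k != j)]) => [k kij|no_k].
  by exists k.
have : (size (enum 'I_n) <= size [:: i; j])%N.
  apply: uniq_leq_size (enum_uniq _) _ => k _; rewrite !inE.
  by have /= := no_k k; case: eqP => //= _ /negbFE.
by rewrite -cardE card_ord leqNgt n2.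
Qed.

Theorem proposition4 (R : realType) (n : nat) (hn : (2 < n)%N)
    (a : 'I_n -> R) (ha : forall k, 0 < a k)
    (l u : R) (hl : 0 < l) (hlu : l < u)
    (p q : R) (hp : 0 < p) (hpq : p < q)
    (i j : 'I_n) (hij : i <> j)
    (hbeta : \sum_(k < n) a k <= 1) :
  upper_envelope (power_monomial a)
    (level_band (power_monomial a) l u `&` ratio_cone p q i j) =
  [set w : 'rV[R]_n * R^o |
    [/\ orthant w.1,
        (w.2 : R) <= \prod_(k < n) w.1 0 k `^ a k,
        (w.2 : R) <= u,
        p * w.1 0 i <= w.1 0 j <= q * w.1 0 i &
        l <= \prod_(k < n) w.1 0 k `^ a k]].

Proof.
have {}hij : i != j by exact/eqP.
apply/seteqP; split.
  apply: smallest_sub.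
    move=> /= [x z] [y w] s /set_mem/= [x0 zx zu xW lx].
    move=> /set_mem/= [y0 wy wu yW ly]; apply/mem_set => /=.
    (* Since [l > 0], every point of the right-hand side has positive coordinates, so concavity is
       only needed in the open orthant. *)
    have x_gt0 := power_monomial_gt0_coord ha x0 (lt_le_trans hl lx).
    have y_gt0 := power_monomial_gt0_coord ha y0 (lt_le_trans hl ly).
    rewrite /conv/= /unstable.onem /(_ *: (z : R^o)) /(_ *: (w : R^o)) /=.
    have : 0 <= s%:num <= 1 by exact/andP.
    move: (s%:num) => {}s s01.
    have := power_monomial_concave ha hbeta s01 x_gt0 y_gt0.
    rewrite -!/(power_monomial a _) in zx wy lx ly *.
    set m := _ *: x + _ *: y => concave.
    have mE b : m 0 b = s * x 0 b + (1 - s) * y 0 b by rewrite !mxE.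
    split; [|apply: le_trans concave|..|apply: le_trans concave].
    - by move=> b; have := x0 b; have := y0 b; rewrite mE; nra.
    - by nra.
    - by nra.
    - by rewrite !mE; nra.
    - by nra.
  move=> [x z] /= [[[x0 /andP[lx xu]] [_ xW]] zx]; split => //=.
  exact: le_trans xu.
move=> [x z] /= [x0 zx zu xW lx].
have [xu|ux] := leP (power_monomial a x) u.
  by apply: sub_gen_smallest; split => //=; split => //; split => //; rewrite lx.
have x_gt0 := power_monomial_gt0_coord ha x0 (lt_le_trans hl lx).
have fx_gt0 := power_monomial_gt0 a x_gt0.
have [k /andP[ki kj]] := third_index i j hn.
(* To land on the level [u], the tilt must multiply the value at [x] by this factor. *)
have c01 : 0 < u / power_monomial a x < 1.
  by rewrite divr_gt0 ?ltr_pdivrMr ?mul1r// (lt_trans hl).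
have [s [t [/andP[s0 s1] /andP[t0 t1] fs ft]]] :=
  power_monomial_tilt_exit hij ki kj ha c01.
pose y (v : R) : 'rV[R]_n := \row_m (x 0 m * tilt i j k v 0 m).
have tilt_ge0 (v : R) : -1 < v < 1 -> orthant (tilt i j k v).
  by move=> v1 m; rewrite mxE; case: ifP => _; [lra|case: ifP => _; lra].
have hyp_y (v : R) : -1 < v < 1 ->
    power_monomial a (tilt i j k v) = u / power_monomial a x ->
    hypograph (power_monomial a)
      (level_band (power_monomial a) l u `&` ratio_cone p q i j) (y v, z).
  move=> v1 fv; have r0 := tilt_ge0 _ v1.
  have fy : power_monomial a (y v) = u.
    by rewrite power_monomial_mul// fv mulrC divfK// gt_eqF.
  have y0 : orthant (y v) by move=> m; rewrite mxE mulr_ge0.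
  split; last by rewrite [leRHS]fy.
  split; split=> //; first by rewrite [power_monomial a _]fy lexx ltW.
  (* The common factor [1 + v > 0] cancels from the cone inequalities. *)
  by rewrite !mxE !eqxx orbT /= !mulrA !ler_pM2r//; lra.
have st0 : 0 < s + t by rewrite addr_gt0.
have lam0 : 0 <= t / (s + t) by rewrite divr_ge0// ltW.
have lam1 : t / (s + t) <= 1 by rewrite ler_pdivrMr// mul1r; lra.
move=> C [/= convC hypC].
have s_bd : -1 < s < 1 by lra.
have t_bd : -1 < - t < 1 by lra.
(* As [y v] is affine in [v] with [y 0 = x], the weights are those that average [s] and [- t] to
   0. *)
have xzE : (x, z) = t / (s + t) *: (y s, z) +
    (1 - t / (s + t)) *: (y (- t), z) :> 'rV[R]_n * R^o.
  apply/pair_equal_spec; split => /=; last first.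
    by rewrite -scalerDl addrC subrK scale1r.
  apply/rowP => b; rewrite !mxE; case: ifP => _; [|case: ifP => _];
    by field; rewrite gt_eqF.
rewrite xzE; apply/set_mem.
exact: (convC _ _ (Itv01 lam0 lam1) (mem_set (hypC _ (hyp_y _ s_bd fs)))
  (mem_set (hypC _ (hyp_y _ t_bd ft)))).
Qed.
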